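(* Let $k\ge 2$. The order $\leq_u$ on $F_k$ induced by an oriented word $u$ of rank $k$ is an extension of the lexicographic order on the monoid $\mathcal{A}^*$ based on $a_1<a_2<\dots<a_k$ if and only if the word $u$ has the form $$u=a_1a_2\dots a_kA_{j_1}A_{j_2}\dots A_{j_k},$$ where $j_1,j_2,\dots,j_k$ is some permutation of $1,2,\dots,k$.
   Context: Let $k\ge 2$ and let $\mathcal{A}=\{a_1,\dots,a_k\}$ be a basis of the free group $F_k$. For $a\in\mathcal{A}$ the inverse is denoted by the corresponding uppercase letter ($A=a^{-1}$, $B=b^{-1}$, $A_i=a_i^{-1}$). Letters in $\mathcal{A}$ are called positive (lowercase), letters in $\mathcal{A}^{-1}$ negative (uppercase), and $\mathcal{A}^{\pm}=\mathcal{A}\cup\mathcal{A}^{-1}$. Elements of $F_k$ are identified with reduced group words over $\mathcal{A}^\pm$; $e$ is the trivial element. An oriented word of rank $k$ is a word of length $2k$ over $\mathcal{A}^\pm$ containing each letter of $\mathcal{A}^\pm$ exactly once. For distinct $x,y\in\mathcal{A}^\pm$, ''$x..y$ in $u$'' means that $x$ is to the left of $y$ in $u$. $\#_w(g)$ is the number of (possibly overlapping) occurrences of $w$ as a contiguous subword of $g$. For an oriented word $u$ of rank $k$ and a reduced word $g$, define $$\alpha_u(g)=\sum_{a,b\in\mathcal{A},\ A..B\text{ in }u}\#_{aB}(g)-\sum_{a,b\in\mathcal{A},\ a..b\text{ in }u}\#_{Ba}(g),$$ $$\beta_u(g)=\sum_{a,b\in\mathcal{A},\ A..b\text{ in }u}\#_{ab}(g)-\sum_{a,b\in\mathcal{A},\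 A..b\text{ in }u}\#_{BA}(g)$$ (sums over ordered pairs $(a,b)$; in $\beta_u$ the case $a=b$ is allowed), and let $\omega(g)=\frac12$ if the last letter of $g$ is in $\mathcal{A}$, $\omega(g)=-\frac12$ if it is in $\mathcal{A}^{-1}$, $\omega(e)=0$. The weight induced by $u$ is $\tau_u=\alpha_u+\beta_u+\omega$ (always evaluated on reduced forms). The left order $\leq_u$ on $F_k$ induced by $u$ is the one with positive cone $P_u=\{g\in F_k\mid\tau_u(g)>0\}$, i.e. $g<_u h$ if and only if $g^{-1}h\in P_u$. $\mathcal{A}^*$ is the free monoid of all words over $\mathcal{A}$, viewed as a submonoid of $F_k$. The lexicographic order on $\mathcal{A}^*$ based on $a_1<\dots<a_k$ is the usual dictionary order: a proper prefix of a word is smaller than the word, and otherwise words are compared at the first letter where they differ. ''Extension'' means that the restriction of $\leq_u$ to $\mathcal{A}^*$ is this lexicographic order. *)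

(* Defs.v *)
From HB Require Import structures.
From mathcomp Require Import all_boot all_order all_fingroup all_algebra.

Set Implicit Arguments.
Unset Strict Implicit.
Unset Printing Implicit Defensive.

Import Order.TTheory GRing.Theory Num.Theory.

(* The generator a_{i+1} is indexed by i : 'I_k, so that a_1 < ... < a_k is the
   natural order of 'I_k; [pos i] is that generator and [neg i] its inverse. *)
Notation letter k := ('I_k + 'I_k)%type.

Definition pos {k} (a : 'I_k) : letter k := inl a.
Definition neg {k} (a : 'I_k) : letter k := inr a.

Definition inv_letter {k} (x : letter k) : letter k :=
  match x with inl a => neg a | inr a => pos a end.

Lemma inv_letterK k : involutive (@inv_letter k).
Proof. by case. Qed.

Definition reduced {k} (s : seq (letter k)) : bool :=
  sorted (fun x y => y != inv_letter x) s.

Definition push {k} (x : letter k) (s : seq (letter k)) : seq (letter k) :=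
  if s is y :: s' then if y == inv_letter x then s' else x :: s else [:: x].

Definition reduce {k} (s : seq (letter k)) : seq (letter k) :=
  foldr push [::] s.

Lemma push_reduced k (x : letter k) s : reduced s -> reduced (push x s).
Proof.
case: s => [|y s] //= ys; case: ifPn => [_|nyx] /=; first exact: path_sorted ys.
by rewrite /reduced /= nyx.
Qed.

Lemma foldr_push_reduced k (s t : seq (letter k)) :
  reduced t -> reduced (foldr push t s).
Proof. by move=> t_red; elim: s => //= x s; apply: push_reduced. Qed.

Lemma reduce_reduced k (s : seq (letter k)) : reduced (reduce s).
Proof. exact: foldr_push_reduced. Qed.

Lemma reduce_id k (s : seq (letter k)) : reduced s -> reduce s = s.
Proof.
elim: s => //= x s IHs xs; rewrite (IHs (path_sorted xs)).
by case: s xs {IHs} => //= y s /andP[/negPf-> _].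
Qed.

Lemma pushK k (x : letter k) s : reduced s -> push (inv_letter x) (push x s) = s.
Proof.
case: s => [|y s] /=; first by rewrite inv_letterK eqxx.
case: eqVneq => [->|nyx] //=; last by rewrite inv_letterK eqxx.
by case: s => //= z s /andP[/negPf-> _].
Qed.

Lemma foldr_push k (x : letter k) s t : reduced t ->
  foldr push t (push x s) = push x (foldr push t s).
Proof.
move=> t_red; case: s => [|y s] //=; case: eqVneq => //= ->.
have := pushK (inv_letter x) (foldr_push_reduced s t_red).
by rewrite inv_letterK => ->.
Qed.

Lemma foldr_reduce k (s t : seq (letter k)) : reduced t ->
  foldr push t (reduce s) = foldr push t s.
Proof. by move=> t_red; elim: s => //= x s IHs; rewrite foldr_push // IHs. Qed.

Lemma reduce_cat k (s t : seq (letter k)) :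
  reduce (s ++ t) = foldr push (reduce t) s.
Proof. exact: foldr_cat. Qed.

Lemma reduce_catl k (s t : seq (letter k)) :
  reduce (reduce s ++ t) = reduce (s ++ t).
Proof. by rewrite !reduce_cat foldr_reduce // reduce_reduced. Qed.

Lemma reduce_catr k (s t : seq (letter k)) :
  reduce (s ++ reduce t) = reduce (s ++ t).
Proof. by rewrite !reduce_cat reduce_id // reduce_reduced. Qed.

Record free_group (k : nat) : Type :=
  FreeGroup { fword :> seq (letter k); fword_reduced : reduced fword }.

HB.instance Definition _ k := [isSub for @fword k].
HB.instance Definition _ k := [Countable of free_group k by <:].

(* the element of F_k represented by an arbitrary word over A^{+-} *)
Definition fg_of_word {k} (s : seq (letter k)) : free_group k :=
  FreeGroup (reduce_reduced s).

Definition fg_one {k} : free_group k := fg_of_word [::].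
Definition fg_mul {k} (g h : free_group k) : free_group k := fg_of_word (g ++ h).
Definition fg_inv {k} (g : free_group k) : free_group k :=
  fg_of_word (rev (map inv_letter g)).

Lemma fg_mulA k : associative (@fg_mul k).
Proof.
by move=> g h i; apply: val_inj; rewrite /= reduce_catl reduce_catr catA.
Qed.

Lemma fg_mul1 k : left_id fg_one (@fg_mul k).
Proof. by move=> [s s_red]; apply: val_inj; rewrite /= reduce_id. Qed.

Lemma fg_mulr1 k : right_id fg_one (@fg_mul k).
Proof. by move=> [s s_red]; apply: val_inj; rewrite /= cats0 reduce_id. Qed.

Lemma reduce_inv k (s : seq (letter k)) :
  reduce (rev (map inv_letter s) ++ s) = [::].
Proof.
elim: s => //= x s IHs; rewrite rev_cons cat_rcons reduce_cat /=.
by rewrite pushK ?reduce_reduced // -reduce_cat.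
Qed.

Lemma fg_mulV k : left_inverse fg_one fg_inv (@fg_mul k).
Proof.
by move=> g; apply: val_inj; rewrite /= reduce_catl reduce_inv.
Qed.

Lemma fg_mulrV k : right_inverse fg_one fg_inv (@fg_mul k).
Proof.
move=> g; apply: val_inj; rewrite /= reduce_catr.
have := reduce_inv (rev (map inv_letter g)).
by rewrite map_rev revK (mapK (@inv_letterK k)).
Qed.

HB.instance Definition _ k := isGroup.Build (free_group k)
  (@fg_mulA k) (@fg_mul1 k) (@fg_mulr1 k) (@fg_mulV k) (@fg_mulrV k).

Local Open Scope ring_scope.

Definition oriented_word {k} (u : seq (letter k)) : bool :=
  (size u == k.*2) && [forall x, count_mem x u == 1%N].

(* "x..y in u"; only meaningful when x and y both occur in u, and false if
   x = y *)
Definition before {k} (u : seq (letter k)) (x y : letter k) : bool :=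
  (index x u < index y u)%N.

(* #_w(g): positions of g at which the nonempty word w starts *)
Definition occ {k} (w g : seq (letter k)) : nat :=
  \sum_(i < size g) prefix w (drop i g).

Definition alpha {k} (u : seq (letter k)) (g : free_group k) : rat :=
  \sum_a \sum_(b | before u (neg a) (neg b)) (occ [:: pos a; neg b] g)%:R
  - \sum_a \sum_(b | before u (pos a) (pos b)) (occ [:: neg b; pos a] g)%:R.

Definition beta {k} (u : seq (letter k)) (g : free_group k) : rat :=
  \sum_a \sum_(b | before u (neg a) (pos b)) (occ [:: pos a; pos b] g)%:R
  - \sum_a \sum_(b | before u (neg a) (pos b)) (occ [:: neg b; neg a] g)%:R.

Definition omega {k} (g : free_group k) : rat :=
  match rev g with
  | [::] => 0
  | inl _ :: _ => 1 / 2
  | inr _ :: _ => - (1 / 2)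
  end.

Definition tau {k} (u : seq (letter k)) (g : free_group k) : rat :=
  alpha u g + beta u g + omega g.

Definition pos_cone {k} (u : seq (letter k)) : pred (free_group k) :=
  [pred g | 0 < tau u g].

Definition lt_u {k} (u : seq (letter k)) (g h : free_group k) : bool :=
  (g^-1 * h)%g \in pos_cone u.

Definition le_u {k} (u : seq (letter k)) (g h : free_group k) : bool :=
  (g == h) || lt_u u g h.

(* the inclusion of the free monoid A^* into F_k *)
Definition of_pos {k} (v : seq 'I_k) : free_group k := fg_of_word (map pos v).

(* [seqlexi 'I_k] is [seq 'I_k] with the lexicographic order induced by 'I_k. *)
Definition extends_lex {k} (u : seq (letter k)) : Prop :=
  forall v w : seqlexi 'I_k,
    le_u u (of_pos v) (of_pos w) = (v <= w)%O.

(* Main.v *)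
Require Import Defs.
From mathcomp Require Import all_boot all_order all_fingroup all_algebra.
From mathcomp Require Import lra.

(** Let [v] and [w] be positive words.  After cancelling the common prefix,
    [v^-1 w] is either trivial or the reduced word [V w], where [V] is the
    negative word inverse to [v].  Its weight only sees three things: the
    pairs [ab] with [A..b] inside [w] (each counted +1), the same pairs inside
    [v] (each counted -1 through [BA]), and, when both words are nonempty with
    first letters [c] of [v] and [d] of [w], the turn [Cd], which costs 1
    exactly when [d..c] in [u].  Writing [ascents u w] for the number of pairs
    [ab] of [w] with [A..b], this gives ([tau_quot])
      [tau u (V w) = ascents u w - ascents u v - (d..c) + 1/2],
    while [tau] is [ascents u w + 1/2 > 0] if only [v] is empty, and
    [- ascents u v - 1/2 < 0] if only [w] is.  Thus proper prefixes are always smaller, whatever [u] is.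

    If positive letters occur in [u] in increasing order and before every
    negative letter, then [ascents u] vanishes and the sign of [1/2 - (d..c)]
    is the comparison of [c] and [d]: the order is lexicographic.

    Conversely, comparing one-letter words forces the positive letters of [u]
    to be in increasing order; and if [A..b] for some [a], [b], then
    [a_1 a b] has an ascent which outweighs its turn with [a_2], so that it
    lies above [a_2], against the lexicographic order ([extends_lexP]).

    Finally an oriented word is determined by its relation [before], so these
    two conditions describe exactly the words
    [a_1 ... a_k A_(j_1) ... A_(j_k)] ([oriented_shapeP]). *)

Set Implicit Arguments.
Unset Strict Implicit.
Unset Printing Implicit Defensive.

Import Order.TTheory GRing.Theory Num.Theory.

(** * Occurrences of two-letter words *)

Lemma occ_nil k (p : seq (letter k)) : occ p [::] = 0.
Proof. by rewrite /occ big_ord0. Qed.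

Lemma occ_cons k (p : seq (letter k)) x s :
  occ p (x :: s) = prefix p (x :: s) + occ p s.
Proof. by rewrite /occ big_ord_recl. Qed.

(** In a concatenation, the only new occurrence of a two-letter word is the
    one straddling the junction. *)
Lemma occ_cat2 k (x y : letter k) s t :
  occ [:: x; y] (s ++ t) =
    occ [:: x; y] s + ((ohead (rev s) == Some x) && (ohead t == Some y))
    + occ [:: x; y] t.
Proof.
elim: s => [|z s IHs]; first by rewrite occ_nil.
rewrite cat_cons !occ_cons IHs.
case: s {IHs} => [|z' s] /=.
  rewrite occ_nil andbF !add0n; congr (_ + _).
  case: t => [|z' t]; rewrite ?andbF //= prefix0s andbT.
  by rewrite !(inj_eq Some_inj) [x == z]eq_sym [y == z']eq_sym.
rewrite !prefix0s !addnA !rev_cons; congr (_ + _ + (_ && _) + _).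
by case: (rev s).
Qed.

Lemma occ2_notin k (x y : letter k) s :
  ~~ ((x \in s) && (y \in s)) -> occ [:: x; y] s = 0.
Proof.
elim: s => [|z s IHs] xys; first exact: occ_nil.
rewrite occ_cons IHs ?addn0; last first.
  by apply: contra xys => /andP[xs ys]; rewrite !inE xs ys !orbT.
apply/eqP; rewrite eqb0; apply: contra xys => /=.
case: s {IHs} => [|z' s] /=; first by rewrite andbF.
by rewrite prefix0s !inE => /and3P[/eqP-> /eqP-> _]; rewrite !eqxx orbT.
Qed.

(** Inverting a word reverses it and inverts its letters; this is what turns
    the [BA]-terms of [beta] on [v^-1] into the [ab]-terms on [v]. *)
Lemma occ2_inv k (x y : letter k) s :
  occ [:: inv_letter y; inv_letter x] (rev (map inv_letter s)) =
  occ [:: x; y] s.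
Proof.
elim: s => [|z s IHs]; first by rewrite !occ_nil.
have occ1 x' y' (z' : letter k) : occ [:: x'; y'] [:: z'] = 0.
  by rewrite occ_cons occ_nil /= andbF.
rewrite /= rev_cons -cats1 -[z :: s]/([:: z] ++ s) !occ_cat2 IHs !occ1.
rewrite revK add0n addn0 addnC; congr (_ + _).
have invE z' x' : (inv_letter z' == inv_letter x') = (z' == x' :> letter k).
  exact: (can_eq (@inv_letterK k)).
rewrite andbC; case: s {IHs} => [|z' s] //=;
by rewrite !(inj_eq Some_inj) !invE.
Qed.

(** * The weight of a quotient of positive words *)

(** The value of [beta] on a positive word. *)
Definition ascents {k} (u : seq (letter k)) (v : seq 'I_k) : rat :=
  (\sum_a \sum_(b | before u (neg a) (pos b))
     (occ [:: pos a; pos b] (map pos v))%:R)%R.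

Lemma ascents_ge0 k (u : seq (letter k)) v : (0 <= ascents u v)%R.
Proof. by apply: sumr_ge0 => a _; apply: sumr_ge0 => b _; apply: ler0n. Qed.

Lemma ascents_nil k (u : seq (letter k)) : (ascents u [::] = 0)%R.
Proof.
rewrite /ascents big1 // => a _; rewrite big1 // => b _.
by rewrite occ_nil.
Qed.

Lemma ascents1 k (u : seq (letter k)) c : (ascents u [:: c] = 0)%R.
Proof.
rewrite /ascents big1 // => a _; rewrite big1 // => b _.
by rewrite occ_cons occ_nil /= andbF.
Qed.

Lemma ascents_eq0 k (u : seq (letter k)) v :
  (forall a b, ~~ before u (neg a) (pos b)) -> (ascents u v = 0)%R.
Proof.
move=> noAb; rewrite /ascents big1 // => a _.
by rewrite big_pred0 // => b; apply: negbTE.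
Qed.

Lemma ascents_ge1 k (u : seq (letter k)) c a b :
  before u (neg a) (pos b) -> (1 <= ascents u [:: c; a; b])%R.
Proof.
move=> Ab.
have sum_ge0 P (F : 'I_k -> nat) : (0 <= \sum_(i | P i) (F i)%:R :> rat)%R.
  by apply: sumr_ge0 => i _; apply: ler0n.
rewrite /ascents (bigD1 a) //= (bigD1 b) //= 2!occ_cons /= !eqxx /=.
rewrite -addrA natrD natrD -!addrA addrCA lerDl.
by rewrite !addr_ge0 ?ler0n ?sum_ge0 // sumr_ge0.
Qed.

(** The positive word [w] following the inverse of the positive word [v]: in
    reduced form, this is [v^-1 w] when [v] and [w] have no common prefix. *)
Definition quot_word {k} (v w : seq 'I_k) : seq (letter k) :=
  rev (map inv_letter (map pos v)) ++ map pos w.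

(** The contribution of the junction [Cd] of [quot_word v w], the only place
    where a negative letter meets a positive one. *)
Definition turn {k} (u : seq (letter k)) (v w : seq 'I_k) : rat :=
  if (v, w) is (c :: _, d :: _) then (before u (pos d) (pos c))%:R%R else 0%R.

Lemma neg_notin_pos k (a : 'I_k) v : neg a \notin map pos v.
Proof. by apply/mapP => -[]. Qed.

Lemma pos_notin_inv k (a : 'I_k) v :
  pos a \notin rev (map inv_letter (map pos v)).
Proof. by rewrite mem_rev -map_comp; apply/mapP => -[]. Qed.

Lemma beta_quot k (u : seq (letter k)) (v w : seq 'I_k) (g : free_group k) :
  fword g = quot_word v w -> beta u g = (ascents u w - ascents u v)%R.
Proof.
move=> gE; rewrite /beta /ascents gE.
congr (_ - _)%R; apply: eq_bigr => a _; apply: eq_bigr => b _; congr (_%:R)%R.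
  rewrite occ_cat2 occ2_notin ?(negPf (pos_notin_inv _ _)) // revK.
  by case: v {gE}.
rewrite occ_cat2 [X in _ + X]occ2_notin ?(negPf (neg_notin_pos _ _)) // addn0.
rewrite -(@occ2_inv _ (pos a)) /=.
by case: w {gE} => [|d w]; rewrite andbF addn0.
Qed.

Lemma alpha_quot k (u : seq (letter k)) (v w : seq 'I_k) (g : free_group k) :
  fword g = quot_word v w -> alpha u g = (- turn u v w)%R.
Proof.
move=> gE; rewrite /alpha gE [X in (X - _)%R]big1 => [|a _]; last first.
  rewrite big1 // => b _; rewrite occ_cat2 revK.
  rewrite !occ2_notin ?(negPf (neg_notin_pos _ _)) ?andbF //.
    by case: v {gE}.
  by rewrite (negPf (pos_notin_inv _ _)).
rewrite sub0r; congr (- _)%R.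
have crossE a b : occ [:: neg b; pos a] (quot_word v w) =
    (ohead v == Some b) && (ohead w == Some a).
  rewrite occ_cat2 revK !occ2_notin ?(negPf (neg_notin_pos _ _)) //; last first.
    by rewrite (negPf (pos_notin_inv _ _)) andbF.
  by rewrite addn0; case: v {gE} => [|c v]; case: w => [|d w].
under eq_bigr => a _ do under eq_bigr => b _ do rewrite crossE.
rewrite /turn; case: v {gE crossE} => [|c v].
  by rewrite big1 // => a _; rewrite big1.
case: w => [|d w] /=.
  by rewrite big1 // => a _; rewrite big1 // => b _; rewrite andbF.
rewrite (bigD1 d) //= [X in (_ + X)%R]big1 ?addr0 => [|a nad]; last first.
  rewrite big1 // => b _.
  by rewrite [Some d == _](inj_eq Some_inj) [d == a]eq_sym (negPf nad) andbF.
rewrite big_mkcond /= (bigD1 c) //= !eqxx big1 ?addr0 => [|b nbc].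
  by case: before.
by rewrite [Some c == _](inj_eq Some_inj) [c == b]eq_sym (negPf nbc) if_same.
Qed.

Lemma omega_quot k (v w : seq 'I_k) (g : free_group k) :
  fword g = quot_word v w ->
  omega g = (if w is _ :: _ then 1 / 2 else
             if v is _ :: _ then - (1 / 2) else 0)%R.
Proof.
move=> gE; rewrite /omega gE rev_cat revK -map_rev.
case: w {gE} => [|d w]; first by case: v.
by case/lastP: w => [|w d']; rewrite rev_cons ?rev_rcons.
Qed.

Lemma tau_quot k (u : seq (letter k)) (v w : seq 'I_k) (g : free_group k) :
  fword g = quot_word v w ->
  tau u g = (ascents u w - ascents u v - turn u v w
             + if w is _ :: _ then 1 / 2 else
               if v is _ :: _ then - (1 / 2) else 0)%R.
Proof.
move=> gE; rewrite /tau (alpha_quot _ gE) (beta_quot _ gE) (omega_quot gE).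
by congr (_ + _)%R; rewrite addrC.
Qed.

(** * Comparing positive words *)

Lemma reduced_pos k (v : seq 'I_k) : reduced (map pos v).
Proof. by elim: v => //= c [|d v]. Qed.

Lemma fword_of_pos k (v : seq 'I_k) : fword (of_pos v) = map pos v.
Proof. exact: reduce_id (reduced_pos v). Qed.

Lemma of_pos_inj k : injective (@of_pos k).
Proof.
move=> v w /(congr1 (@fword k)); rewrite !fword_of_pos.
by apply: inj_map => a b [].
Qed.

Lemma of_pos_cons k (c : 'I_k) v :
  of_pos (c :: v) = (of_pos [:: c] * of_pos v)%g.
Proof.
apply: val_inj.
rewrite -[RHS]/(reduce (reduce (map pos [:: c]) ++ reduce (map pos v))).
by rewrite reduce_catl reduce_catr.
Qed.

Lemma le_u_cons k (u : seq (letter k)) (c : 'I_k) v w :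
  le_u u (of_pos (c :: v)) (of_pos (c :: w)) = le_u u (of_pos v) (of_pos w).
Proof.
rewrite /le_u (of_pos_cons c v) (of_pos_cons c w) (inj_eq (mulgI _)).
by congr (_ || _); rewrite /lt_u invMg -mulgA mulKg.
Qed.

Lemma fword_quot k (v w : seq 'I_k) : reduced (quot_word v w) ->
  fword ((of_pos v)^-1 * of_pos w)%g = quot_word v w.
Proof.
move=> red_vw; rewrite -[RHS](reduce_id red_vw).
rewrite -[LHS]/(reduce (reduce (rev (map inv_letter (fword (of_pos v))))
                        ++ fword (of_pos w))).
by rewrite reduce_catl !fword_of_pos.
Qed.

Lemma reduced_inv_cat k (v : seq 'I_k) t :
    reduced t -> (forall c, ohead v = Some c -> ohead t != Some (pos c)) ->
  reduced (rev (map inv_letter (map pos v)) ++ t).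
Proof.
elim: v t => [|c v IHv] t //= red_t ct; rewrite rev_cons cat_rcons.
apply: IHv => //; have := ct c erefl.
by case: t red_t {ct} => //= y t; rewrite /reduced /= => ->; rewrite andbT.
Qed.

Lemma tau_of_pos_quot k (u : seq (letter k)) (v w : seq 'I_k) :
    (if (v, w) is (c :: _, d :: _) then c != d else true) ->
  tau u ((of_pos v)^-1 * of_pos w)%g =
    (ascents u w - ascents u v - turn u v w
     + if w is _ :: _ then 1 / 2 else if v is _ :: _ then - (1 / 2) else 0)%R.
Proof.
move=> heads; apply/tau_quot/fword_quot/reduced_inv_cat.
  exact: reduced_pos.
move=> c; case: v heads => //= c' v + [<-].
by case: w => // d w; rewrite /= eq_sym; apply: contraNneq => -[->].
Qed.

(** When one of the words is empty there is no turn, and the ascents of the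
    other contribute to the weight with the same sign as [omega]; so this
    comparison and the next one come out the same for every [u]. *)
Lemma le_u0s k (u : seq (letter k)) w : le_u u (of_pos [::]) (of_pos w).
Proof.
case: w => [|d w]; first by rewrite /le_u eqxx.
rewrite /le_u /lt_u inE tau_of_pos_quot //; apply/orP; right.
by have := ascents_ge0 u (d :: w); rewrite /turn ascents_nil; lra.
Qed.

Lemma le_us0 k (u : seq (letter k)) c v :
  le_u u (of_pos (c :: v)) (of_pos [::]) = false.
Proof.
rewrite /le_u /lt_u inE tau_of_pos_quot // (inj_eq (@of_pos_inj k)) /=.
apply/negbTE; rewrite -leNgt.
by have := ascents_ge0 u (c :: v); rewrite /turn ascents_nil; lra.
Qed.

(** The only competition is between the final [omega = 1/2], the turn, and the
    ascents on both sides; without ascents the turn alone decides. *)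
Lemma le_u_turn k (u : seq (letter k)) c d v w : c != d ->
  le_u u (of_pos (c :: v)) (of_pos (d :: w)) =
  (0 < ascents u (d :: w) - ascents u (c :: v)
       - (before u (pos d) (pos c))%:R + 1 / 2)%R.
Proof.
move=> ncd; rewrite /le_u /lt_u inE tau_of_pos_quot //.
by rewrite (inj_eq (@of_pos_inj k)) eqseq_cons (negPf ncd).
Qed.

(** Singletons, which have no ascents, isolate the turn; this gives the first
    condition.  A quotient has at most one turn, and a single ascent in the
    lexicographically smaller word is enough to compensate for it and reverse
    the comparison; this gives the second. *)
Lemma extends_lexP k (u : seq (letter k)) : 2 <= k ->
  extends_lex u <->
  (forall a b, before u (pos a) (pos b) = (a < b)) /\
  (forall a b, ~~ before u (neg a) (pos b)).
Proof.
move=> k_ge2; split=> [ext | [posE noAb]].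
  have posE a b : before u (pos a) (pos b) = (a < b).
    have [->|nab] := eqVneq a b; first by rewrite /before !ltnn.
    have := ext [:: b] [:: a]; rewrite le_u_turn 1?eq_sym // !ascents1.
    rewrite lexi_cons /= implybT andbT leEord ltnNge => <-.
    by case: before.
  split=> // a b; apply/negP => Ab.
  (* [a2^-1 a1 a b] has weight at least 1 - 1 + 1/2, although [a1 < a2]. *)
  pose a1 := Ordinal (ltnW k_ge2); pose a2 := Ordinal k_ge2.
  have := ext [:: a2] [:: a1; a; b].
  rewrite le_u_turn // lexi_cons posE ascents1 leEord.
  have [-> ->] : (a1 < a2) = true /\ (a2 <= a1) = false by [].
  move/negbT; rewrite -leNgt /nat_of_bool.
  by have := ascents_ge1 a1 Ab; lra.
elim=> [|c v IHv] [|d w].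
- by rewrite le_u0s lexi0s.
- by rewrite le_u0s lexi0s.
- by rewrite le_us0 lexis0.
rewrite lexi_cons; have [<-|ncd] := eqVneq c d.
  by rewrite le_u_cons lexx /= IHv.
rewrite le_u_turn // !ascents_eq0 // posE subrr sub0r !leEord.
case: (ltngtP c d) => [||/val_inj cd] /=; last by rewrite cd eqxx in ncd.
  by move=> _; lra.
by move=> _; apply/negbTE; rewrite -leNgt; lra.
Qed.

(** * The shape of the oriented word *)

Lemma oriented_uniq k (u : seq (letter k)) : oriented_word u -> uniq u.
Proof.
case/andP=> _ /forallP u1; apply: count_mem_uniq => x; rewrite (eqP (u1 x)).
by rewrite -has_pred1 has_count (eqP (u1 x)).
Qed.

Lemma mem_oriented k (u : seq (letter k)) x : oriented_word u -> x \in u.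
Proof.
by case/andP=> _ /forallP /(_ x) /eqP u1; rewrite -has_pred1 has_count u1.
Qed.

Lemma before_total k (u : seq (letter k)) x y : oriented_word u ->
  x != y -> ~~ before u x y -> before u y x.
Proof.
move=> uO; rewrite /before -leqNgt leq_eqVlt => nxy /orP[/eqP eyx|//].
by rewrite (index_inj x (mem_oriented y uO) (mem_oriented x uO) eyx) eqxx in nxy.
Qed.

Lemma sorted_before k (u : seq (letter k)) : uniq u -> sorted (before u) u.
Proof.
case: u => // x u u_uniq; apply/(sortedP x) => i lt_i.
by rewrite /before !index_uniq // ltnW.
Qed.

Definition neg_index {k} (x : letter k) : option 'I_k :=
  if x is inr a then Some a else None.

Lemma neg_indexK k : ocancel (@neg_index k) neg.
Proof. by case. Qed.

Lemma perm_ordP k (l : seq 'I_k) : perm_eq l (enum 'I_k) ->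
  exists j : 'S_k, l = [seq j i | i <- enum 'I_k].
Proof.
rewrite -val_ord_tuple => /tuple_permP[j ->]; exists j.
by apply: eq_map => i; rewrite tnth_ord_tuple.
Qed.

(** The relation [before u] is a strict order for which [u] is sorted, and a
    sorted sequence is determined by its set of entries: it suffices that the
    claimed form of [u] is also sorted for [before u], where the indices of
    the negative letters are simply listed in their order of occurrence. *)
Lemma oriented_shapeP k (u : seq (letter k)) : oriented_word u ->
  ((forall a b, before u (pos a) (pos b) = (a < b)) /\
   (forall a b, ~~ before u (neg a) (pos b))) <->
  exists j : 'S_k,
    u = [seq pos i | i <- enum 'I_k] ++ [seq neg (j i) | i <- enum 'I_k].
Proof.
move=> uO; have before_trans : transitive (before u).
  by move=> y x z; apply: ltn_trans.
have pos_inj : injective (@pos k) by move=> a b [].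
split=> [[posE noAb] | [j ->]]; last first.
  have index_pos a : index (pos a) ([seq pos i | i <- enum 'I_k]
      ++ [seq neg (j i) | i <- enum 'I_k]) = a.
    by rewrite index_cat map_f ?mem_enum // index_map // index_enum_ord.
  split=> a b; rewrite /before !index_pos // -leqNgt index_cat.
  rewrite (negPf (neg_notin_pos _ _)) size_map size_enum_ord.
  exact: leq_trans (ltnW (ltn_ord b)) (leq_addr _ _).
have u_uniq := oriented_uniq uO.
have [|j lE] := @perm_ordP k (pmap neg_index u).
  apply: uniq_perm; [exact: (pmap_uniq (@neg_indexK k)) | exact: enum_uniq |].
  move=> a; rewrite mem_enum (can2_mem_pmap (@neg_indexK k)) //.
  exact: mem_oriented.
exists j; rewrite (map_comp neg j) -lE.
have filterE : map neg (pmap neg_index u) = [seq x <- u | neg_index x].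
  by elim: (u) => //= -[a|a] s /= ->.
apply: (irr_sorted_eq before_trans).
- by move=> x; rewrite /before ltnn.
- exact: sorted_before.
- rewrite sorted_pairwise // pairwise_cat; apply/and3P; split.
  + apply/allrelP => _ _ /mapP[a _ ->] /mapP[b _ ->].
    exact: before_total uO _ (noAb b a).
  + rewrite pairwise_map -sorted_pairwise; last first.
      by move=> b a c; apply: before_trans.
    have := iota_ltn_sorted 0 k; rewrite -val_enum_ord sorted_map.
    by apply: sub_sorted => a b /=; rewrite posE.
  + rewrite filterE -sorted_pairwise //.
    exact: sorted_filter (sorted_before u_uniq).
- move=> x; rewrite (mem_oriented _ uO) mem_cat; case: x => a.
    by rewrite map_f ?mem_enum.
  by rewrite filterE mem_filter (mem_oriented _ uO) orbT.
Qed.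

Theorem proposition17 (k : nat) (k_ge2 : 2 <= k) (u : seq (letter k))
    (u_oriented : oriented_word u) :
  extends_lex u <->
  exists j : 'S_k,
    u = [seq pos i | i <- enum 'I_k] ++ [seq neg (j i) | i <- enum 'I_k].
Proof. exact: iff_trans (extends_lexP u k_ge2) (oriented_shapeP u_oriented). Qed.
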